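(* For any finite poset $P$ with $n$ elements and any antichain $A$ of $P$, $$\sum_{x\in A}\mathrm{win}(x)\ge \frac{(n+1)|A|^2}{n}.$$
   Context: $f$ is a uniformly random linear extension of $P$ (order-preserving bijection $P\to\{1,\dots,n\}$). For $x\in P$, $r(x)=\min\{f(y):y>x\}$ (equal to $n+1$ if $x$ is maximal), $q(x)=\max\{f(y):y<x\}$ (equal to $0$ if $x$ is minimal), and $\mathrm{win}(x)=\mathbb{E}[r(x)-q(x)]$. *)

(* Defs.v *)
From HB Require Import structures.
From mathcomp Require Import all_boot all_order all_algebra.
Set Implicit Arguments.
Unset Strict Implicit.
Unset Printing Implicit Defensive.
Import Order.TTheory GRing.Theory Num.Theory.
Local Open Scope ring_scope.

(* A linear extension P -> {1, ..., n} is encoded as f : P -> 'I_n = {0, ..., n-1}, *)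
(* n = #|P|; the label of x in {1, ..., n} is [label f x] = f x + 1.               *)
Definition linexts (d : Order.disp_t) (P : finPOrderType d) :
    {set {ffun P -> 'I_#|P|}} :=
  [set f : {ffun P -> 'I_#|P|} |
    [&& injectiveb f, [forall i, i \in codom f]
      & [forall x, forall y, (x <= y)%O ==> (f x <= f y)%N]]].

Definition label (d : Order.disp_t) (P : finPOrderType d)
  (f : {ffun P -> 'I_#|P|}) (x : P) : nat := (f x).+1.

(* All labels are at most n, so the seed n + 1 matters only for maximal x. *)
Definition upper (d : Order.disp_t) (P : finPOrderType d)
  (f : {ffun P -> 'I_#|P|}) (x : P) : nat :=
  \big[minn/#|P|.+1]_(y : P | (x < y)%O) label f y.

Definition lower (d : Order.disp_t) (P : finPOrderType d)
  (f : {ffun P -> 'I_#|P|}) (x : P) : nat :=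
  \max_(y : P | (y < x)%O) label f y.

Definition expect_linext (d : Order.disp_t) (P : finPOrderType d)
  (X : {ffun P -> 'I_#|P|} -> rat) : rat :=
  (\sum_(f in linexts P) X f) / #|linexts P|%:R.

Definition win (d : Order.disp_t) (P : finPOrderType d) (x : P) : rat :=
  expect_linext (fun f => (upper f x)%:R - (lower f x)%:R).

Definition antichain (d : Order.disp_t) (P : finPOrderType d) (A : {set P}) : Prop :=
  {in A &, forall x y, x != y -> (x >< y)%O}.

(* Main.v *)
(** Put [s_x(f) = r(x) - q(x) - 1], the number of positions that [x] can take in
    [f] when the other elements keep their relative order.  Grouping the linear
    extensions by the order induced on [P - x] gives
    [\sum_f 1 / s_x(f) = #{f | f(x) = q(x) + 1}].  Follow the promotion path of
    a linear extension: it carries the element at position 1 upwards, handing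
    over to a new element exactly when the latter sits right after a smaller
    one.  As the path is a chain, it meets the antichain [A] at most once, hence
    [\sum_(x in A) #{f | f(x) = q(x) + 1} <= e(P)].  The inequality between
    arithmetic and harmonic means then yields
    [\sum_(x in A) win(x) >= |A| + |A|^2], which is stronger than the claim
    because [|A| <= n]. *)

Require Import Defs.
From HB Require Import structures.
From mathcomp Require Import all_boot all_order all_algebra.
From mathcomp Require Import zify ring lra.
Import Order.TTheory GRing.Theory Num.Theory.
Local Open Scope ring_scope.

Section LinearExtensions.

Set Implicit Arguments.
Unset Strict Implicit.

Variables (d : Order.disp_t) (P : finPOrderType d).
Implicit Types (f g h : {ffun P -> 'I_#|P|}) (x y z : P) (k : nat).

(** * Basic properties and existence of linear extensions *)

Lemma linextsP f :
  reflect (injective f /\ {homo f : x y / (x <= y)%O >-> (x <= y)%N})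
          (f \in linexts P).
Proof.
rewrite inE; apply: (iffP and3P) => [[/injectiveP fi _ /forallP fm]|[fi fm]].
  by split=> // x y xy; move/forallP: (fm x) => /(_ y)/implyP; apply.
split; first exact/injectiveP.
  by apply/forallP=> i; apply: inj_card_onto => //; rewrite card_ord.
by apply/forallP=> x; apply/forallP=> y; apply/implyP; apply: fm.
Qed.

Lemma linext_inj f : f \in linexts P -> injective f.
Proof. by case/linextsP. Qed.

Lemma linext_eq f k x y : f \in linexts P ->
  f x = k :> nat -> f y = k :> nat -> x = y.
Proof. by move=> fL fx fy; apply/(linext_inj fL)/val_inj; rewrite /= fx fy. Qed.

Lemma linext_lt f x y : f \in linexts P -> (x < y)%O -> (f x < f y)%N.
Proof.
case/linextsP=> fi fm xy; rewrite ltn_neqAle fm ?ltW// andbT.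
by apply: contraTneq xy => /val_inj/fi ->; rewrite ltxx.
Qed.

Lemma linext_onto f k :
  f \in linexts P -> (k < #|P|)%N -> exists x, f x = k :> nat.
Proof.
rewrite inE => /and3P[_ /forallP fo _] kn.
by have /codomP[x xE] := fo (Ordinal kn); exists x; rewrite -xE.
Qed.

(** Elements are sorted by the size of their strict down-set; since [enum_rank] stays below [#|P|],
    it only breaks ties in [key]. This makes the division in [expect_linext] meaningful. *)
Lemma linexts_gt0 : (0 < #|linexts P|)%N.
Proof.
pose key x := (#|[set y | (y < x)%O]| * #|P| + enum_rank x)%N.
have key_lt x y : (x < y)%O -> (key x < key y)%N.
  move=> xy; have : (#|[set z | (z < x)%O]| < #|[set z | (z < y)%O]|)%N.
    apply: proper_card; apply/properP; split.
      by apply/subsetP=> z; rewrite !inE => /lt_trans; apply.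
    by exists x; rewrite inE ?ltxx.
  move=> lt_xy; apply: (@leq_trans (#|[set z | (z < x)%O]|.+1 * #|P|)).
    by rewrite mulSnr ltn_add2l ltn_ord.
  by rewrite (leq_trans (leq_mul lt_xy (leqnn _))) ?leq_addr.
have key_inj : injective key.
  move=> x y /(congr1 (modn^~ #|P|)).
  by rewrite !modnMDl !modn_small// => /val_inj/enum_rank_inj.
have rank_lt x : (#|[set y | (key y < key x)%N]| < #|P|)%N.
  apply: proper_card; apply/properP; split; first by apply/subsetP.
  by exists x; rewrite ?inE ?ltnn.
have rank_mono x y : (key x < key y)%N ->
    (#|[set z | (key z < key x)%N]| < #|[set z | (key z < key y)%N]|)%N.
  move=> xy; apply: proper_card; apply/properP; split.
    by apply/subsetP=> z; rewrite !inE => /ltn_trans; apply.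
  by exists x; rewrite inE ?ltnn.
apply/card_gt0P; exists [ffun x => Ordinal (rank_lt x)].
apply/linextsP; split=> x y.
  rewrite !ffunE => /(congr1 val)/= E; apply: key_inj.
  by case: (ltngtP (key x) (key y)) => // /rank_mono; rewrite E ltnn.
rewrite le_eqVlt !ffunE => /predU1P[->//|xy].
by rewrite ltnW// rank_mono// key_lt.
Qed.

(** * Adjacent transpositions of positions *)

Definition swap_nat k m :=
  if m == k then k.+1 else if m == k.+1 then k else m.

Lemma swap_natK k : involutive (swap_nat k).
Proof. move=> m; rewrite /swap_nat; do ?case: ifP; lia. Qed.

Lemma swap_nat_homo k m p : (m < p)%N -> (m = k -> p = k.+1 -> False) ->
  (swap_nat k m <= swap_nat k p)%N.
Proof. rewrite /swap_nat; do ?case: eqP; lia. Qed.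

Definition swapped k f g := [forall z, g z == swap_nat k (f z) :> nat].

(* The Bender-Knuth involutions, whose composite is promotion. *)
Definition tau k f : {ffun P -> 'I_#|P|} :=
  odflt f [pick g in linexts P | swapped k f g].

Lemma swappedP k f g :
  reflect (forall z, g z = swap_nat k (f z) :> nat) (swapped k f g).
Proof. exact: 'forall_eqP. Qed.

Lemma swapped_sym k f g : swapped k f g -> swapped k g f.
Proof. by move/swappedP=> fg; apply/swappedP=> z; rewrite fg swap_natK. Qed.

Lemma swapped_uniq k f g h : swapped k f g -> swapped k f h -> g = h.
Proof.
move=> /swappedP fg /swappedP fh.
by apply/ffunP=> z; apply: val_inj; rewrite /= fg fh.
Qed.

Lemma tau_swapped k f g : g \in linexts P -> swapped k f g -> tau k f = g.
Proof.
move=> gL fg; rewrite /tau; case: pickP => [h /andP[_ fh]|/(_ g)] /=.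
  exact: swapped_uniq fh fg.
by rewrite gL fg.
Qed.

Variant tau_spec k f : {ffun P -> 'I_#|P|} -> Type :=
  | TauSwap g of g \in linexts P & swapped k f g : tau_spec k f g
  | TauStay of (forall g, g \in linexts P -> ~~ swapped k f g) : tau_spec k f f.

Lemma tauP k f : tau_spec k f (tau k f).
Proof.
rewrite /tau; case: pickP => [g /andP[gL fg]|no] /=; first exact: TauSwap.
by apply: TauStay => g gL; move: (no g); rewrite gL /= => ->.
Qed.

Lemma tau_linext k f : f \in linexts P -> tau k f \in linexts P.
Proof. by move=> fL; case: tauP. Qed.

Lemma tauK k : {in linexts P, involutive (tau k)}.
Proof.
move=> f fL; case: {2}(tau k f) / (tauP k f) (erefl (tau k f)) => [g gL fg|no] E.
  by rewrite E; apply: tau_swapped => //; apply: swapped_sym.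
by rewrite !E.
Qed.

Lemma tau_inj k : {in linexts P &, injective (tau k)}.
Proof. by move=> f g fL gL E; rewrite -(tauK k fL) E tauK. Qed.

(** Exchanging [k] and [k.+1] reverses only the pair at these two positions, so only a relation
    within that pair can block it. *)
Lemma swapped_linext k f x : f \in linexts P -> f x = k.+1 :> nat ->
  (forall z, f z = k :> nat -> ~~ (z < x)%O) ->
  exists2 g, g \in linexts P & swapped k f g.
Proof.
move=> fL fx nlt; have [fi fm] := linextsP _ fL.
have sn z : (swap_nat k (f z) < #|P|)%N.
  have := ltn_ord (f x); have := ltn_ord (f z).
  by rewrite /swap_nat; do ?case: ifP; lia.
exists [ffun z => Ordinal (sn z)]; last by apply/swappedP=> z; rewrite ffunE.
apply/linextsP; split=> y z; rewrite !ffunE.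
  by move=> /(congr1 val)/= /(can_inj (swap_natK k))/val_inj/fi.
rewrite le_eqVlt => /predU1P[->//|yz] /=.
have noswap : f y = k :> nat -> f z = k.+1 :> nat -> False.
  move=> fy fz; have zx := linext_eq fL fz fx.
  by move: (nlt _ fy); rewrite -zx yz.
exact: swap_nat_homo (linext_lt fL yz) noswap.
Qed.

(** * Bounds for [lower] and [upper] *)

Lemma lower_le f x y : (y < x)%O -> (f y < lower f x)%N.
Proof.
by move=> yx; apply: (@leq_bigmax_cond _ (fun z => z < x)%O (label f) y).
Qed.

Lemma lower_le_linext f x : f \in linexts P -> (lower f x <= f x)%N.
Proof. by move=> fL; apply/bigmax_leqP=> y; apply: linext_lt. Qed.

Lemma upper_gt_linext f x : f \in linexts P -> ((f x).+1 < upper f x)%N.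
Proof.
move=> fL; rewrite /upper; elim/big_ind: _ => [|a b|y xy].
- by rewrite ltnS ltn_ord.
- by rewrite leq_min => -> ->.
- by rewrite ltnS linext_lt.
Qed.

Lemma upper_le f x : (upper f x <= #|P|.+1)%N.
Proof.
rewrite /upper; elim/big_ind: _ => // [a b ? _|y _]; last exact: ltnW (ltn_ord _).
by rewrite geq_min; apply/orP; left.
Qed.

Lemma lower_witness f x :
  (0 < lower f x)%N -> exists2 y, (y < x)%O & (f y).+1 = lower f x.
Proof.
rewrite /lower => lt0.
have [/card_gt0P[y yx]|] := ltnP 0 #|[pred y | (y < x)%O]|; last first.
  rewrite leqn0 => /eqP/card0_eq no.
  by move: lt0; rewrite big_pred0.
have [|z zx zE] := @eq_bigmax_cond _ [pred y | (y < x)%O] (label f).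
  by apply/card_gt0P; exists y.
by exists z => //; rewrite [RHS]zE.
Qed.

(** * Partial promotion *)

Fixpoint promote k f := if k is j.+1 then tau j (promote j f) else f.

Lemma promote_linext k f : f \in linexts P -> promote k f \in linexts P.
Proof. by move=> fL; elim: k => //= k; apply: tau_linext. Qed.

Lemma promote_inj k : {in linexts P &, injective (promote k)}.
Proof.
move=> f g fL gL; elim: k => //= k IH E.
by apply: IH; apply: (tau_inj _ _ E); apply: promote_linext.
Qed.

(* The element sitting at position [k] after [k] steps only moves up in [P]. *)
Lemma promote_path_le f i j x y : f \in linexts P -> (i <= j)%N ->
  promote i f x = i :> nat -> promote j f y = j :> nat -> (x <= y)%O.
Proof.
move=> fL; elim: j y => [|j IH] y ij fx fy.
  move: ij fx; rewrite leqn0 => /eqP-> fx.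
  by rewrite (linext_eq (promote_linext 0 fL) fx fy).
move: ij; rewrite leq_eqVlt => /predU1P[ij|ij].
  by rewrite ij in fx; rewrite (linext_eq (promote_linext j.+1 fL) fx fy).
move: fy => /=; have gL := promote_linext j fL.
case: tauP => [g _ /swappedP gE|no] fy.
  apply: IH => //; move: fy; rewrite gE /swap_nat.
  by do ?case: eqP; lia.
have [z zE] : exists z, promote j f z = j :> nat.
  by apply: linext_onto => //; apply: ltn_trans (ltnSn j) _; rewrite -fy.
apply: (le_trans (IH z ij fx zE)).
(* Were [z] not below [y], the swap would give a linear extension, against [no]. *)
have [/ltW//|nzy] := boolP (z < y)%O.
have [|g g_L sw] := @swapped_linext j (promote j f) y gL fy.
  by move=> t tE; rewrite (linext_eq gL tE zE).
by move: (no g g_L); rewrite sw.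
Qed.

(* [f x] counts from 0 and [lower f x] from 1, so the second equation says
   that a predecessor of [x] comes right before it (or that [x] is first). *)
Definition tight k f x := (f x == k :> nat) && (lower f x == k).

(** Tightness puts some [z] below [y] at position [j - 1]. This [z] blocked the last swap, so it was
    the path element one step earlier, and [x <= z < y]. *)
Lemma tight_promote_lt f i j x y : f \in linexts P -> (i < j)%N ->
  promote i f x = i :> nat -> tight j (promote j f) y -> (x < y)%O.
Proof.
case: j => // j fL ij fx /andP[/eqP fy /eqP ly].
have [|z zy] := @lower_witness (promote j.+1 f) y; first by rewrite ly.
rewrite ly => -[zE]; apply: (le_lt_trans _ zy).
apply: (@promote_path_le f i j) => //.
(* Had the swap taken place, [y] would have preceded [z] before it, although [z] is below [y]. *)
move: fy zE => /=; case: tauP => [g gL /swappedP gE|//] fy zE.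
have := linext_lt (promote_linext j fL) zy.
by move: fy zE; rewrite !gE /swap_nat; do ?case: eqP; lia.
Qed.

Lemma tight_promote_uniq (A : {set P}) f i j x y : antichain A ->
  f \in linexts P -> x \in A -> y \in A ->
  tight i (promote i f) x -> tight j (promote j f) y -> i = j /\ x = y.
Proof.
move=> hA fL xA yA ti tj.
have fx : promote i f x = i :> nat by apply/eqP; case/andP: ti.
have fy : promote j f y = j :> nat by apply/eqP; case/andP: tj.
have anti u v : u \in A -> v \in A -> ~~ (u < v)%O.
  move=> uA vA; apply/negP=> uv.
  by move: (hA u v uA vA (negbT (lt_eqF uv))); rewrite lt_comparable.
case: (ltngtP i j) => [ij|ji|ij].
- by move: (anti _ _ xA yA); rewrite (tight_promote_lt fL ij fx tj).
- by move: (anti _ _ yA xA); rewrite (tight_promote_lt fL ji fy ti).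
- by rewrite -ij in fy; rewrite (linext_eq (promote_linext i fL) fx fy).
Qed.

Lemma reindex_promote k (F : {ffun P -> 'I_#|P|} -> nat) :
  (\sum_(f in linexts P) F f = \sum_(f in linexts P) F (promote k f))%N.
Proof.
rewrite -(big_imset F (@promote_inj k)); apply: eq_bigl => f.
suff -> : [set promote k g | g in linexts P] = linexts P by [].
apply/eqP; rewrite eqEcard card_in_imset ?leqnn ?andbT; last exact: promote_inj.
by apply/subsetP=> _ /imsetP[g gL ->]; apply: promote_linext.
Qed.

Lemma sum_tight_le (A : {set P}) : antichain A ->
  (\sum_(x in A) #|[set f in linexts P | f x == lower f x :> nat]|
   <= #|linexts P|)%N.
Proof.
move=> hA.
have cardE x : (#|[set f in linexts P | f x == lower f x :> nat]| =
    \sum_(k < #|P|) \sum_(f in linexts P) tight k f x)%N.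
  rewrite exchange_big /= -sum1_card big_mkcond /= [RHS]big_mkcond /=.
  apply: eq_bigr => f _; rewrite inE; case: (f \in linexts P) => //=.
  rewrite (bigD1 (f x)) //= big1 => [|k kx].
    by rewrite addn0 /tight eqxx eq_sym; case: eqP.
  by rewrite /tight -(inj_eq val_inj) /= eq_sym in kx *; rewrite (negbTE kx).
under eq_bigr do rewrite cardE.
rewrite exchange_big /=.
(* Position [k] is inspected after [k] promotion steps, so that each [f] collects tight pairs along
   its own promotion path, where [A] allows at most one. *)
under eq_bigr => k _ do rewrite exchange_big (reindex_promote k) /=.
rewrite exchange_big /= -[leqRHS]sum1_card; apply: leq_sum => f fL.
rewrite pair_big /=.
pose T := [set p : 'I_#|P| * P | (p.2 \in A) && tight p.1 (promote p.1 f) p.2].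
suff : (#|T| <= 1)%N.
  apply: leq_trans; rewrite -sum1_card big_mkcond [in leqRHS]big_mkcond /=.
  by apply: leq_sum => p _; rewrite inE; case: (_ \in A); case: (tight _ _ _).
apply/card_le1_eqP=> -[i x] [j y]; rewrite !inE /= => /andP[xA ti] /andP[yA tj].
by have [/val_inj -> ->] := tight_promote_uniq hA fL xA yA ti tj.
Qed.

(** * The number of free positions of an element *)

(** This is [s_x(f)]. Truncation is harmless: [upper] exceeds [lower] by at least 2 on linear
    extensions. *)
Definition room f x := (upper f x - lower f x).-1.

Lemma room_gt f x : f \in linexts P -> (f x - lower f x < room f x)%N.
Proof.
move=> fL; rewrite /room.
have := lower_le_linext x fL; have := upper_gt_linext x fL; lia.
Qed.

Lemma room_le f x : (room f x < #|P|.+1)%N.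
Proof. by rewrite /room; have := upper_le f x; lia. Qed.

(** The offset [j] is counted from the lowest free position of [x]: as [lower] counts from 1 and
    [f x] from 0, [j = 0] means right after [q(x)]. *)
Definition room_class x m j :=
  [set f in linexts P | (room f x == m) && (f x == (lower f x + j)%N :> nat)].

(* Moving [x] one position down maps a class injectively into the next one. *)
Lemma card_room_classS x m j : (#|room_class x m j.+1| <= #|room_class x m j|)%N.
Proof.
pose h f := tau (f x).-1 f.
have hP f : f \in room_class x m j.+1 ->
    [/\ f \in linexts P, h f \in room_class x m j & (f x).-1 = h f x].
  rewrite inE => /and3P[fL /eqP fm /eqP fx].
  pose k := (lower f x + j)%N.
  have fxk : f x = k.+1 :> nat by rewrite fx addnS.
  have hE : h f = tau k f by rewrite /h fxk.
  have [|g gL sw] := @swapped_linext k f x fL fxk.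
    by move=> z zE; apply/negP=> /(lower_le f); rewrite zE /k; lia.
  have gE := swappedP _ _ _ sw.
  have gx : g x = k :> nat by rewrite gE fxk /swap_nat eqxx; case: eqP => //; lia.
  (* Predecessors of [x] sit before position [k] and successors after [k.+1], so the swap moves none
     of them. *)
  have lowE : lower g x = lower f x.
    apply: eq_bigr => y yx; congr _.+1; rewrite gE /swap_nat.
    by have := lower_le f yx; do ?case: eqP; rewrite /k; lia.
  have uppE : upper g x = upper f x.
    apply: eq_bigr => y xy; congr _.+1; rewrite gE /swap_nat.
    by have := linext_lt fL xy; do ?case: eqP; lia.
  have E : h f = g by rewrite hE; apply: tau_swapped.
  rewrite E gx fxk; split=> //.
  by rewrite inE gL /room lowE uppE -/(room f x) fm gx !eqxx.
rewrite -(@card_in_imset _ _ h) => [|f1 f2 /hP[L1 _ k1] /hP[L2 _ k2] E].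
  by apply/subset_leq_card/subsetP=> _ /imsetP[f /hP[_ ? _] ->].
(* The image reveals which [tau] was applied: its index is the new position of [x]. *)
apply: (@tau_inj (f1 x).-1) => //; rewrite -/(h f1) E /h; congr tau.
by rewrite k1 k2 E.
Qed.

Lemma card_room_class x m j : (#|room_class x m j| <= #|room_class x m 0|)%N.
Proof. by elim: j => // j; apply: leq_trans; apply: card_room_classS. Qed.

(** The offset of [x] is less than [m], so [m] classes cover the set, each no larger than that of
    offset 0. *)
Lemma card_room x m :
  (#|[set f in linexts P | room f x == m]| <= m * #|room_class x m 0|)%N.
Proof.
rewrite -[X in (_ <= X * _)%N]card_ord -sum_nat_const.
apply: (@leq_trans (\sum_(j < m) #|room_class x m j|)); last first.
  by apply: leq_sum => j _; apply: card_room_class.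
have sub : [set f in linexts P | room f x == m] \subset
           \bigcup_(j < m) room_class x m j.
  apply/subsetP=> f; rewrite inE => /andP[fL /eqP fm].
  have lt_m : (f x - lower f x < m)%N by rewrite -fm room_gt.
  apply/bigcupP; exists (Ordinal lt_m) => //=.
  by rewrite inE fL fm eqxx /= subnKC ?lower_le_linext.
apply: leq_trans (subset_leq_card sub) _.
elim/big_ind2: _ => [|a B b C aB bC|//]; first by rewrite cards0.
by rewrite (leq_trans (leq_card_setU _ _))// leq_add.
Qed.

Lemma sum_inv_room x :
  \sum_(f in linexts P) (room f x)%:R^-1 <=
  #|[set f in linexts P | f x == lower f x :> nat]|%:R :> rat.
Proof.
pose p f : 'I_#|P|.+1 := Ordinal (room_le f x).
rewrite (partition_big p predT) //=.
have -> : #|[set f in linexts P | f x == lower f x :> nat]| =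
    (\sum_(m < #|P|.+1) #|room_class x m 0|)%N.
  rewrite -sum1_card (partition_big p predT) //=; apply: eq_bigr => m _.
  rewrite -[RHS]sum1_card; apply: eq_bigl => f.
  by rewrite !inE addn0 -andbA -(inj_eq val_inj) /=; congr andb; rewrite andbC.
rewrite natr_sum; apply: ler_sum => m _.
rewrite (eq_bigr (fun=> m%:R^-1)); last first.
  by move=> f /andP[_ /eqP <-].
have -> : \sum_(f in linexts P | p f == m) m%:R^-1 =
    #|[set f in linexts P | room f x == m]|%:R * m%:R^-1 :> rat.
  rewrite mulr_natl -sumr_const; apply: eq_bigl => f.
  by rewrite inE -(inj_eq val_inj).
(* For [m = 0] the inverse is 0 by convention. *)
have [->|m0] := posnP (nat_of_ord m); first by rewrite invr0 mulr0.
by rewrite ler_pdivrMr ?ltr0n// mulrC -natrM ler_nat card_room.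
Qed.

Lemma win_room x :
  win x = 1 + (\sum_(f in linexts P) (room f x)%:R) / #|linexts P|%:R.
Proof.
have e0 : #|linexts P|%:R != 0 :> rat by rewrite pnatr_eq0 -lt0n linexts_gt0.
rewrite /win /expect_linext -[X in _ = X + _](divff e0) -mulrDl; congr (_ / _).
rewrite -sumr_const -big_split; apply: eq_bigr => f fL /=.
rewrite -natrB; last first.
  by have := lower_le_linext x fL; have := upper_gt_linext x fL; lia.
rewrite nat1r; congr _%:R; rewrite /room.
by have := lower_le_linext x fL; have := upper_gt_linext x fL; lia.
Qed.

End LinearExtensions.

(** * The bound from the arithmetic and harmonic means *)

Theorem theorem2p9 (d : Order.disp_t) (P : finPOrderType d) (A : {set P})
    (hA : antichain A) :
  \sum_(x in A) win x >= (#|P|%:R + 1) * #|A|%:R ^+ 2 / #|P|%:R.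
Proof.
set a : rat := #|A|%:R; set e : rat := #|linexts P|%:R.
have e0 : 0 < e by rewrite ltr0n linexts_gt0.
have a0 : 0 <= a by rewrite ler0n.
have room_sum : a ^+ 2 * e <=
    \sum_(x in A) \sum_(f in linexts P) (room f x)%:R.
  have inv_le : \sum_(x in A) \sum_(f in linexts P) (room f x)%:R^-1 <= e.
    apply: le_trans (ler_sum _ (fun x _ => sum_inv_room x)) _.
    by rewrite -natr_sum ler_nat sum_tight_le.
  (* Tangent line of the convex function [s |-> a ^+ 2 / s] at [s = a]. *)
  have tangent x f : f \in linexts P ->
      2 * a - a ^+ 2 * (room f x)%:R^-1 <= (room f x)%:R.
    move=> fL; set s : rat := (room f x)%:R.
    have s0 : 0 < s by rewrite ltr0n (leq_trans _ (room_gt x fL)).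
    rewrite -subr_ge0.
    have -> : s - (2 * a - a ^+ 2 * s^-1) = (s - a) ^+ 2 / s.
      by field; rewrite gt_eqF.
    by rewrite divr_ge0 ?sqr_ge0// ltW.
  apply: (@le_trans _ _ (\sum_(x in A) \sum_(f in linexts P)
      (2 * a - a ^+ 2 * (room f x)%:R^-1))); last first.
    by apply: ler_sum => x _; apply: ler_sum => f; apply: tangent.
  (* The constants add up to [2 * a ^+ 2 * e], and by [inv_le] the reciprocals remove at most
     [a ^+ 2 * e]. *)
  under eq_bigr do rewrite sumrB sumr_const -mulr_sumr -[X in X - _]mulr_natr.
  rewrite sumrB sumr_const -mulr_sumr -[X in X - _]mulr_natr -/a -/e.
  have : a ^+ 2 * (\sum_(x in A) \sum_(f in linexts P) (room f x)%:R^-1)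
      <= a ^+ 2 * e by rewrite ler_wpM2l ?sqr_ge0.
  by lra.
apply: (@le_trans _ _ (a + a ^+ 2)).
  (* For empty [P] the quotient is 0 by convention; otherwise the claim reduces to
     [a ^+ 2 / n <= a], that is, to [|A| <= n]. *)
  have [P0|P0] := posnP #|P|.
    by rewrite P0 invr0 mulr0 addr_ge0 ?sqr_ge0.
  rewrite ler_pdivrMr ?ltr0n//.
  have : a <= #|P|%:R by rewrite ler_nat max_card.
  by nra.
under eq_bigr do rewrite win_room.
rewrite big_split /= sumr_const -mulr_suml -/a -/e lerD2l.
by rewrite ler_pdivlMr.
Qed.
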